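(* Let $k\ge 1$ be an integer. The algorithm for generating atomistic lattices on $k$ atoms described in the context, run on input $k$, returns $\mathcal{L}_k$; that is, it returns a container consisting of exactly one representative of each isomorphism class of finite atomistic lattices with exactly $k$ atoms.
   Context: All lattices are finite. In a lattice $L$ with minimum $\hat 0$, an atom is an element covering $\hat 0$; $L$ is atomistic if every element can be written as a join of atoms ($\hat 0$ being the empty join). An element of $L$ is meet-irreducible if it is covered by exactly one other element. $\mathcal{L}_k$ denotes the set of all isomorphism classes of finite atomistic lattices with exactly $k$ atoms. $\mathfrak{B}(k)$ denotes the boolean lattice of all subsets of a $k$-element set. Quotients. For a meet-irreducible $a\in L$, let $a_+$ be the unique element covering $a$, and let $\sim_a$ be the equivalence relation on $L$ which identifies $a$ with $a_+$ and in which every other element is equivalent only to itself. The quotient $L/\sim_a$ carries a natural lattice structure such that the canonical surjection $\pi_a:L\to L/\sim_a$ preserves joins, i.e. $\pi_a(P\vee Q)=\pi_a(P)\vee\pi_a(Q)$ for all $P,Q\in L$. The algorithm. Input: an integer $k\ge1$. It maintains containers (finite collections) $R$ and $W$ of finite lattices, with $R$ initially empty and $W$ initially consisting of the single lattice $\mathfrak{B}(k)$. While $W$ is nonempty, repeat: (i) replace $R$ by $R\cup W$; (ii) let $V$ be a new empty container; for every lattice $L$ in $W$ and every meet-irreducible element $a\in L$ that is not an atom, insert $L/\sim_a$ into $V$; (iii) replace $W$ by a container holding exactly one representative of each isomorphism class of lattices occurring in $V$. When $W$ is empty, the algorithm returns $R$.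
   Formalization: The theorem assumes k ≥ 2 instead of k ≥ 1: for k = 1 the minimum of B(1) is meet-irreducible and not an atom, so the algorithm also inserts the one-element lattice, which has no atoms, and does not return L_1. *)

(* Defs.v *)
From HB Require Import structures.
From Stdlib Require Relation_Operators.
From mathcomp Require Export all_boot all_order.
From mathcomp Require Export generic_quotient.

Set Implicit Arguments.
Unset Strict Implicit.
Unset Printing Implicit Defensive.

Export Order.TTheory Order.DefaultSetSubsetOrder.
Local Open Scope order_scope.
Local Open Scope quotient_scope.

(* "Finite lattice" is finTBLatticeType: a nonempty finite lattice, whose      *)
(* minimum and maximum are \bot and \top.                                      *)

Definition covers d (L : finTBLatticeType d) (x y : L) : bool :=
  (x < y) && ~~ [exists z : L, x < z < y].

Definition is_atom d (L : finTBLatticeType d) (x : L) : bool := covers \bot x.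

Definition atomistic d (L : finTBLatticeType d) : Prop :=
  forall x : L, exists A : {set L},
    (forall a : L, a \in A -> is_atom a) /\ x = \join_(a in A) a.

Definition meet_irreducible d (L : finTBLatticeType d) (a : L) : bool :=
  #|[set b : L | covers a b]| == 1%N.

(* The default a of odflt is never reached when a is meet-irreducible.         *)
Definition upper_cover d (L : finTBLatticeType d) (a : L) : L :=
  odflt a [pick b | covers a b].

Section Quotient.

Context {d : Order.disp_t} (L : finTBLatticeType d).
Implicit Types x y z : L.

Variable a : {a : L | meet_irreducible a}.

Definition sim : rel L := fun x y =>
  [|| x == y, (x == val a) && (y == upper_cover (val a))
    | (x == upper_cover (val a)) && (y == val a)].

Lemma covers_upper_cover : covers (val a) (upper_cover (val a)).
Proof.
rewrite /upper_cover; case: pickP => //= none.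
have := valP a; rewrite /meet_irreducible (_ : [set b | _] = set0) ?cards0 //.
by apply/setP => x; rewrite !inE none.
Qed.

Lemma lt_upper_cover : val a < upper_cover (val a).
Proof. by case/andP: covers_upper_cover. Qed.

Lemma upper_cover_uniq x : covers (val a) x -> x = upper_cover (val a).
Proof.
have /cards1P[b bP] := valP a => ax; have := covers_upper_cover.
have /[!bP] : x \in [set b : L | covers (val a) b] by rewrite inE.
rewrite inE => /eqP-> ab.
have /[!bP] : upper_cover (val a) \in [set b : L | covers (val a) b].
  by rewrite inE.
by rewrite inE => /eqP->.
Qed.

Lemma upper_cover_le x : val a < x -> upper_cover (val a) <= x.
Proof.
have [n] := ubnP #|[set y | val a < y < x]|.
elim: n x => // n IHn x lexn ax.
have [/existsP[z /andP[az zx]]|no] :=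
  boolP [exists z : L, val a < z < x]; last first.
  by rewrite (@upper_cover_uniq x) // /covers ax.
apply: le_trans (ltW zx); apply: IHn => //; rewrite ltnS in lexn; apply: leq_trans lexn.
apply/proper_card/properP; split.
  by apply/subsetP => y; rewrite !inE => /andP[-> /lt_trans->].
by exists z; rewrite !inE ?az ?zx // ltxx andbF.
Qed.

Definition class_max x : L :=
  if x == val a then upper_cover (val a) else x.

Lemma simE x y : sim x y = (class_max x == class_max y).
Proof.
rewrite /sim /class_max.
have := lt_upper_cover; rewrite lt_def eq_sym => /andP[/negPf neq _].
case: (eqVneq x (val a)) => [->|xa]; case: (eqVneq y (val a)) => [->|ya] //=.
- by rewrite !eqxx.
- by rewrite ?eqxx ?andbF ?orbF eq_sym.
- by rewrite (negPf xa) andbT.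
- by rewrite andbF orbF.
Qed.

Lemma sim_is_equiv : equiv_class_of sim.
Proof.
by split=> [x|x y|y x z]; rewrite !simE // => /eqP->.
Qed.

Canonical sim_equiv := EquivRelPack sim_is_equiv.

Lemma class_max_ge x : x <= class_max x.
Proof.
by rewrite /class_max; case: eqVneq => // ->; apply: ltW lt_upper_cover.
Qed.

Lemma class_max_mono x y : x <= y -> class_max x <= class_max y.
Proof.
rewrite /class_max le_eqVlt => /predU1P[-> //|xy].
case: eqVneq xy => [->|_] xy.
  rewrite gt_eqF //; exact: upper_cover_le.
case: eqVneq xy => [->|_] xy; last exact: ltW.
by apply/ltW/(lt_trans xy)/lt_upper_cover.
Qed.

Lemma class_maxK x : class_max (class_max x) = class_max x.
Proof.
rewrite /class_max; case: (eqVneq x (val a)) => [_|/negPf->] //.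
by rewrite gt_eqF // lt_upper_cover.
Qed.

Lemma class_max_leE x y : (class_max x <= class_max y) = (x <= class_max y).
Proof.
apply/idP/idP => [|/class_max_mono]; last by rewrite class_maxK.
exact/le_trans/class_max_ge.
Qed.

Definition quotient : Type := {eq_quot sim_equiv}.

HB.instance Definition _ := Quotient.on quotient.
HB.instance Definition _ :=
  Finite.copy quotient (can_type (@reprK L quotient)).

Definition pi_quotient : L -> quotient := \pi_quotient.

Definition quotient_join (p q : quotient) : quotient :=
  pi_quotient (repr p `|` repr q).

Definition quotient_le (p q : quotient) : bool := quotient_join p q == q.

(* The join determines the order, hence the meet. The greatest representatives *)
(* are needed: if x <= a_+ but not x <= a, then the meet of the classes of a   *)
(* and x is the class of x = a_+ /\ x, not that of a /\ x.                     *)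
Definition quotient_meet (p q : quotient) : quotient :=
  pi_quotient (class_max (repr p) `&` class_max (repr q)).

Lemma pi_quotientE x y :
  (pi_quotient x == pi_quotient y) = (class_max x == class_max y).
Proof. by rewrite -simE; apply/eqP/idP => /(eqmodP sim_equiv). Qed.

Lemma repr_quotientK : cancel repr pi_quotient.
Proof. exact: reprK. Qed.

Lemma class_max_repr x : class_max (repr (pi_quotient x)) = class_max x.
Proof. by apply/eqP; rewrite -pi_quotientE repr_quotientK. Qed.

Lemma quotient_leE p q :
  quotient_le p q = (class_max (repr p) <= class_max (repr q)).
Proof.
rewrite /quotient_le -{2}[q]repr_quotientK pi_quotientE class_max_leE.
apply/eqP/idP => [<-|le_pq].
  exact: le_trans (leUl _ _) (class_max_ge _).
apply/le_anti; rewrite class_max_leE leUx le_pq class_max_ge.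
exact/class_max_mono/leUr.
Qed.

Lemma quotient_le_refl : reflexive quotient_le.
Proof. by move=> p; rewrite quotient_leE. Qed.

Lemma quotient_le_anti : antisymmetric quotient_le.
Proof.
move=> p q; rewrite !quotient_leE => /le_anti/eqP.
by rewrite -pi_quotientE !repr_quotientK => /eqP.
Qed.

Lemma quotient_le_trans : transitive quotient_le.
Proof. by move=> q p r; rewrite !quotient_leE; apply: le_trans. Qed.

HB.instance Definition _ := Order.Le_isPOrder.Build d quotient
  quotient_le_refl quotient_le_anti quotient_le_trans.

Lemma le_quotientE (p q : quotient) :
  (p <= q) = (class_max (repr p) <= class_max (repr q)).
Proof. exact: quotient_leE. Qed.

Lemma quotient_meetP (p q r : quotient) :
  (p <= quotient_meet q r) = (p <= q) && (p <= r).
Proof.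
rewrite !le_quotientE class_max_repr.
rewrite -lexI; apply/idP/idP => [|/class_max_mono]; last by rewrite class_maxK.
move/le_trans; apply.
by rewrite lexI !class_max_leE leIl leIr.
Qed.

Lemma quotient_joinP (p q r : quotient) :
  (quotient_join p q <= r) = (p <= r) && (q <= r).
Proof.
rewrite !le_quotientE class_max_repr.
by rewrite !class_max_leE leUx.
Qed.

HB.instance Definition _ := Order.POrder_MeetJoin_isLattice.Build d quotient
  quotient_meetP quotient_joinP.

Lemma quotient_le0x (p : quotient) : pi_quotient \bot <= p.
Proof.
by rewrite le_quotientE class_max_repr class_max_mono.
Qed.

Lemma quotient_lex1 (p : quotient) : p <= pi_quotient \top.
Proof.
by rewrite le_quotientE class_max_repr class_max_mono.
Qed.

HB.instance Definition _ := Order.hasBottom.Build d quotient quotient_le0x.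
HB.instance Definition _ := Order.hasTop.Build d quotient quotient_lex1.

Lemma pi_quotient_join : {morph pi_quotient : x y / x `|` y}.
Proof.
move=> x y; apply/eqP; rewrite pi_quotientE eq_le.
rewrite !class_max_leE !leUx.
have h z t : class_max z <= class_max (z `|` t) by rewrite class_max_mono ?leUl.
have := h x y; have := h y x; rewrite joinC => hy hx.
have := h (repr (pi_quotient x)) (repr (pi_quotient y)).
have := h (repr (pi_quotient y)) (repr (pi_quotient x)).
rewrite joinC !class_max_repr !class_max_leE => -> ->.
by rewrite -class_max_leE class_max_repr hx -class_max_leE class_max_repr hy.
Qed.

Lemma pi_quotient_eqP x y : reflect (pi_quotient x = pi_quotient y) (sim x y).
Proof. exact: (eqmodP sim_equiv). Qed.

End Quotient.

(* The display of a lattice only selects notations; it is bundled so that a    *)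
(* container may hold any finite lattice.                                      *)
Record finlat : Type := FinLat {
  finlat_disp : Order.disp_t;
  finlat_sort :> finTBLatticeType finlat_disp
}.

Definition isomorphic (L M : finlat) : Prop :=
  exists f : {lmorphism L -> M}, bijective f.

Definition container := seq finlat.

Definition in_Lk (k : nat) (L : finlat) : Prop :=
  atomistic L /\ #|[set x : L | is_atom x]| = k.

Definition boolean_lattice (k : nat) : finlat := FinLat {set 'I_k}.

Definition occurs_in (V : container) (M : finlat) : Prop :=
  exists i L, onth V i = Some L /\ isomorphic M L.

(* P is meant to be invariant under isomorphism. Uniqueness is that of the     *)
(* position in the container.                                                  *)
Definition one_rep_per_class (P : finlat -> Prop) (C : container) : Prop :=
  (forall i L, onth C i = Some L -> P L) /\
  (forall M, P M -> exists! i, exists2 L, onth C i = Some L & isomorphic M L).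

Definition lattice_quotients (L : finlat) : container :=
  [seq FinLat (quotient a) | a : {a : L | meet_irreducible a}
                               <- enum {: {a : L | meet_irreducible a}}
                           & ~~ is_atom (val a)].

Definition quotients (W : container) : container :=
  flatten [seq lattice_quotients L | L <- W].

(* R is followed by W; the union is a concatenation, so repetitions are kept.  *)
Definition state : Type := (container * container)%type.

Definition init (k : nat) : state := ([::], [:: boolean_lattice k]).

(* One pass through the loop. It is a relation because the choice of           *)
(* representatives is left open.                                               *)
Inductive step : state -> state -> Prop :=
  Step (R W W' : container) of
    W <> [::] & one_rep_per_class (occurs_in (quotients W)) W' :
    step (R, W) (R ++ W, W').

Definition reachable (k : nat) : state -> Prop :=
  Relation_Operators.clos_refl_trans state step (init k).

Definition returns (k : nat) (R : container) : Prop := reachable k (R, [::]).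

(* For k = 1 the algorithm does not return L_1: \bot is meet-irreducible in    *)
(* B(1) and is not an atom, so the one-element lattice is inserted. For k >= 2 *)
(* the element \bot is covered by several atoms in every lattice produced.     *)
Lemma set_ord1 (x : {set 'I_1}) : x = set0 \/ x = setT.
Proof.
have [x0|x0] := boolP (ord0 \in x); [right|left]; apply/setP => i;
  by rewrite !inE (ord1 i) ?x0 // (negPf x0).
Qed.

Lemma covers_set0_ord1 (x : boolean_lattice 1) :
  covers \bot x = (x == setT :> {set 'I_1}).
Proof.
have neq : (set0 : {set 'I_1}) != setT.
  by apply/eqP => /setP/(_ ord0); rewrite !inE.
have lt01 : (set0 : boolean_lattice 1) < setT.
  by rewrite lt_def eq_sym neq; apply: (le0x (setT : boolean_lattice 1)).
case: (set_ord1 x) => ->; first by rewrite (negPf neq) /covers ltxx.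
rewrite eqxx /covers lt01 /=; apply/existsPn => z.
by case: (set_ord1 z) => ->; rewrite ?ltxx ?andbF.
Qed.

Lemma meet_irreducible_bot1 : meet_irreducible (\bot : boolean_lattice 1).
Proof.
rewrite /meet_irreducible (_ : [set b | _] = [set setT]) ?cards1 //.
by apply/setP => x; rewrite !inE covers_set0_ord1.
Qed.

Definition bot1 : {a : boolean_lattice 1 | meet_irreducible a} :=
  exist _ \bot meet_irreducible_bot1.

Lemma card_quotient_bot1 : #|{: quotient bot1}| = 1%N.
Proof.
apply/eqP/fintype1P; set a := bot1.
exists (pi_quotient a \bot) => p; rewrite -[p]repr_quotientK.
have -> : \bot = val a by [].
have [->|->] := set_ord1 (repr p); first by [].
apply/esym/pi_quotient_eqP; rewrite /sim.
by rewrite -(upper_cover_uniq (x := setT)) ?eqxx ?orbT // covers_set0_ord1.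
Qed.

Lemma returns_1_neq_L1 (R : container) :
  returns 1 R -> ~ one_rep_per_class (in_Lk 1) R.
Proof.
pose trivial_in C := exists i (M : finlat), onth C i = Some M /\ #|M| = 1%N.
pose inv s := s = init 1 \/ trivial_in (s.1 ++ s.2).
have invP s t : step s t -> inv s -> inv t.
  case=> R0 W W' _ [_ W'P] [[-> eqW]|[i [M [iM M1]]]]; right; last first.
    exists i, M; split=> //; rewrite onth_cat -onthTE.
    by rewrite iM.
  have QV : occurs_in (quotients W) (FinLat (quotient bot1)).
    rewrite eqW /quotients /= cats0.
    pose bs := [seq a <- enum {: {a : boolean_lattice 1 | meet_irreducible a}}
              | ~~ is_atom (val a)].
    have bot1_s : bot1 \in bs.
      by rewrite mem_filter mem_enum andbT /is_atom /covers ltxx.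
    exists (index bot1 bs), (FinLat (quotient bot1)); split.
      rewrite /lattice_quotients onthE -map_comp (nth_map bot1) ?index_mem //=.
      by rewrite nth_index.
    by exists (@idfun (quotient bot1)); exists id.
  have [i [[N iN [f bij_f]] _]] := W'P _ QV.
  exists (size ([::] ++ W) + i)%N, N; split.
    by rewrite onth_cat ltnNge leq_addr /= addKn.
  by rewrite -(bij_eq_card bij_f) card_quotient_bot1.
have init_inv s t : Relation_Operators.clos_refl_trans _ step s t -> inv s -> inv t.
  by elim=> {s t} [s t /invP|s|s t u _ IH1 _ IH2 /IH1/IH2].
move=> /init_inv[|//|[i [M []]]]; first by left.
rewrite cats0 => iM M1 [/(_ i M iM)[_ atoms1] _].
have /card_gt0P[x] : (0 < #|[set x : M | is_atom x]|)%N by rewrite atoms1.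
rewrite inE => /andP[+ _]; have /fintype1[y yP] := M1.
by rewrite (yP x) (yP \bot) ltxx.
Qed.

(* Main.v *)
From HB Require Import structures.
From Stdlib Require Import Classical Relation_Operators.
Require Import Defs.

Set Implicit Arguments.
Unset Strict Implicit.
Unset Printing Implicit Defensive.

Local Open Scope order_scope.

(** Contracting a meet-irreducible [a] to its cover amounts to deleting [a]:
[class_top] identifies [quotient a] with the poset of the elements other than
[a]. If [a] is not an atom, the atoms survive and still generate, so the
quotient is again atomistic with [k] atoms and has one element less.

Sending an element to the set of atoms below it represents an atomistic lattice
with [k] atoms as a family [F] of subsets of a [k]-element set, closed under
intersection and containing the whole set and the singletons
([in_Lk_set_representation]). For [k > 1], conversely, any such representation
makes a lattice atomistic with [k] atoms ([set_representation_in_Lk]); here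
[k > 1] is what forces the minimum to be represented by the empty set. If [F]
does not contain all subsets, let [X] be minimal among the missing ones.
Intersecting [X] with a member of [F] gives [X] or a proper subset of [X], so
[X |: F] is again closed under intersection; in it, [X] is meet-irreducible,
covered by its closure in [F], and not an atom. Deleting [X] gives back [F].
Hence every atomistic lattice with [k] atoms other than the boolean one is a
quotient of such a lattice with one more element ([in_Lk_is_quotient]).

The algorithm therefore goes through the lattices by decreasing cardinality:
when [W] holds representatives of those with [m] elements, [R] holds
representatives of those with more ([loop_invariant]). Rounds contribute
different cardinalities, so no class is represented twice. When [W] is empty,
no lattice has [m] elements, hence none has fewer, since by the previous
paragraph the cardinalities that occur fill an interval ending at [2 ^ k]
([in_Lk_card_up]); so [R] is complete. *)

(** * Isomorphisms as order isomorphisms *)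

Lemma order_mono_inj d d' (L : porderType d) (M : porderType d')
    (f : L -> M) : {mono f : x y / x <= y} -> injective f.
Proof. exact/mono_inj/le_anti/le_refl. Qed.

(** An order embedding into a lattice that is no larger is onto, and meets and
joins are determined by the order. Isomorphisms are always built in this way
below, so that only an order embedding and a cardinality have to be supplied. *)
Lemma isomorphic_of_mono (L M : finlat) (f : L -> M) :
  {mono f : x y / x <= y} -> (#|M| <= #|L|)%N -> isomorphic L M.
Proof.
move=> fmono leML.
have f_bij : bijective f := inj_card_bij (order_mono_inj fmono) leML.
have [g fK gK] := f_bij.
have fI : Order.meet_morphism f.
  move=> x y; apply/le_anti; rewrite lexI !fmono leIl leIr /=.
  by rewrite -{1}[f x `&` f y]gK fmono lexI -!(fmono (g _)) gK leIl leIr.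
have fU : Order.join_morphism f.
  move=> x y; apply/le_anti; rewrite leUx !fmono leUl leUr !andbT.
  by rewrite -[f x `|` f y]gK fmono leUx -!(fmono _ (g _)) gK leUl leUr.
have f_homo : {homo f : x y / x <= y} by move=> x y; rewrite fmono.
pose mO := Order.isOrderMorphism.Build _ L _ M f f_homo.
pose mI := Order.isMeetLatticeMorphism.Build _ L _ M f fI.
pose mU := Order.isJoinLatticeMorphism.Build _ L _ M f fU.
pose F : {lmorphism L -> M} := HB.pack f mO mI mU.
by exists F.
Qed.

Lemma isomorphic_mono (L M : finlat) :
  isomorphic L M -> exists2 f : L -> M, {mono f : x y / x <= y} & bijective f.
Proof.
move=> [f f_bij]; exists f => // x y.
by rewrite !leEmeet -Order.LatticeMorphismTheory.omorphI (bij_eq f_bij).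
Qed.

Lemma isomorphic_card (L M : finlat) : isomorphic L M -> #|L| = #|M|.
Proof. by case=> f; apply: bij_eq_card. Qed.

Lemma isomorphic_refl (L : finlat) : isomorphic L L.
Proof. exact: (@isomorphic_of_mono L L id). Qed.

Lemma isomorphic_sym (L M : finlat) : isomorphic L M -> isomorphic M L.
Proof.
move=> /[dup]/isomorphic_card eqLM /isomorphic_mono[f fmono [g fK gK]].
by apply: (@isomorphic_of_mono M L g) => [x y|]; rewrite ?eqLM // -fmono !gK.
Qed.

Lemma isomorphic_trans (L M N : finlat) :
  isomorphic L M -> isomorphic M N -> isomorphic L N.
Proof.
move=> LM MN; have eqLN : #|L| = #|N|.
  by rewrite (isomorphic_card LM) (isomorphic_card MN).
have [f fmono _] := isomorphic_mono LM; have [g gmono _] := isomorphic_mono MN.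
by apply: (@isomorphic_of_mono L N (g \o f)) => [x y|]; rewrite ?eqLN //= gmono.
Qed.

Section OrderIso.
Variables (d d' : Order.disp_t) (L : finTBLatticeType d).
Variables (M : finTBLatticeType d') (f : L -> M).
Hypotheses (fmono : {mono f : x y / x <= y}) (f_bij : bijective f).

Lemma iso_covers x y : covers (f x) (f y) = covers x y.
Proof.
have flt : {mono f : x y / x < y} := leW_mono fmono.
rewrite /covers flt; congr (_ && ~~ _).
apply/existsP/existsP => -[z zP]; last by exists (f z); rewrite !flt.
by have [g fK gK] := f_bij; exists (g z); rewrite -!flt gK.
Qed.

Lemma iso_is_atom x : is_atom (f x) = is_atom x.
Proof.
rewrite /is_atom -iso_covers; congr (covers _ _); apply/le_anti.
by have [g fK gK] := f_bij; rewrite le0x -[X in _ <= X]gK fmono le0x.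
Qed.

Lemma iso_meet_irreducible x : meet_irreducible (f x) = meet_irreducible x.
Proof.
rewrite /meet_irreducible -(card_imset _ (bij_inj f_bij)).
congr (#|pred_of_set _| == _).
have [g fK gK] := f_bij.
apply/setP => y; rewrite inE -[y]gK iso_covers mem_imset ?inE //.
exact: bij_inj.
Qed.

End OrderIso.

(** * Lattices of sets *)

(** The requirement on singletons makes [i \in s x] an order statement, namely
[y <= x] for the [y] represented by [[set i]]; hence such an [s] turns meets
into intersections. For [k > 1] these [y] are the atoms. *)
Definition set_representation k d (L : finTBLatticeType d)
    (s : L -> {set 'I_k}) : Prop :=
  {mono s : x y / x <= y >-> x \subset y} /\ forall i, exists x, s x = [set i].

Section SetRepresentation.
Context {k : nat} {d : Order.disp_t} {L : finTBLatticeType d}.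
Variable s : L -> {set 'I_k}.
Hypothesis sP : set_representation s.

Let smono : {mono s : x y / x <= y >-> x \subset y} := sP.1.

Lemma set_representation_inj : injective s.
Proof. exact: (order_mono_inj (M := {set 'I_k})). Qed.

Lemma set_representation_meet x y : s (x `&` y) = s x :&: s y.
Proof.
apply/setP => i; have [z sz] := sP.2 i.
by rewrite inE -!sub1set -sz !smono lexI.
Qed.

Lemma set_representation_top : s \top = setT.
Proof.
apply/setP => i; have [z sz] := sP.2 i.
by rewrite inE -sub1set -sz smono lex1.
Qed.

Hypothesis k_gt1 : (1 < k)%N.

(** The minimum lies below two distinct singletons, which are disjoint. For
[k = 1] this fails: the one-element lattice can be represented by the
singleton. *)
Lemma set_representation_bot : s \bot = set0.
Proof.
apply/eqP; rewrite -subset0.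
pose i0 := Ordinal (ltnW k_gt1); pose i1 := Ordinal k_gt1.
have [[x0 sx0] [x1 sx1]] := (sP.2 i0, sP.2 i1).
have -> : set0 = s x0 :&: s x1.
  by apply/setP => i; rewrite sx0 sx1 !inE; case: eqP => // ->.
by rewrite subsetI !smono !le0x.
Qed.

Lemma set_representation_atom x :
  reflect (exists i, s x = [set i]) (is_atom x).
Proof.
apply: (iffP idP) => [/andP[x_gt0 /existsPn xmin]|[i sx]].
  have [i ix] : exists i, i \in s x.
    apply/set0Pn; rewrite -set_representation_bot.
    by rewrite (inj_eq set_representation_inj) -lt0x.
  exists i; have [y sy] := sP.2 i.
  have y_gt0 : \bot < y.
    rewrite lt0x -(inj_eq set_representation_inj) set_representation_bot sy.
    by apply/set0Pn; exists i; rewrite inE.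
  have := xmin y; rewrite y_gt0 /= lt_neqAle -smono sy sub1set ix andbT negbK.
  by move=> /eqP <-.
have s_neq0 : s x != s \bot.
  by rewrite set_representation_bot sx; apply/set0Pn; exists i; rewrite inE.
rewrite /is_atom /covers lt0x -(inj_eq set_representation_inj) s_neq0 /=.
apply/existsPn => z; apply/negP => /andP[z_gt0]; rewrite lt_neqAle => /andP[zx].
rewrite -smono sx subset1 -sx -set_representation_bot.
rewrite !(inj_eq set_representation_inj) (negPf zx).
by rewrite -(negbK (z == _)) -lt0x z_gt0.
Qed.

(** Each element is the join of the atoms below it because a set is the union of
its singletons. Being given by an order embedding, the criterion passes to
isomorphic lattices and to quotients by mere composition. *)
Lemma set_representation_in_Lk : in_Lk k (FinLat L).
Proof.
have atP := set_representation_atom; split.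
  move=> x; exists [set a | is_atom a & a <= x]; split=> [a|].
    by rewrite inE => /andP[].
  apply/le_anti/andP; split; last by apply/joinsP => a; rewrite inE => /andP[].
  rewrite -smono; apply/subsetP => i ix; have [y sy] := sP.2 i.
  rewrite -sub1set -sy smono; apply: (joins_sup (j := y) id).
  rewrite inE -smono sy sub1set ix andbT.
  by apply/atP; exists i.
have [atom_of atom_ofE] := fin_all_exists sP.2.
have atom_of_inj : injective atom_of.
  by move=> i j /(congr1 s); rewrite !atom_ofE => /set1_inj.
rewrite -[RHS]card_ord -cardsT -(card_imset _ atom_of_inj); apply: eq_card => x.
rewrite inE; apply/atP/imsetP => [[i sx]|[i _ ->]]; exists i => //.
by apply: set_representation_inj; rewrite sx atom_ofE.
Qed.

End SetRepresentation.

Lemma in_Lk_set_representation k (L : finlat) :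
  in_Lk k L -> exists s : L -> {set 'I_k}, set_representation s.
Proof.
move=> [atoms_gen card_atoms]; pose A := [set x : L | is_atom x].
pose atom_of (i : 'I_k) : L := enum_val (cast_ord (esym card_atoms) i).
have atom_of_atom i : is_atom (atom_of i).
  by have := enum_valP (cast_ord (esym card_atoms) i); rewrite inE.
have atomE a : is_atom a -> exists i, a = atom_of i.
  move=> aA; have aA' : a \in A by rewrite inE.
  exists (cast_ord card_atoms (enum_rank_in aA' a)).
  by rewrite /atom_of cast_ordK enum_rankK_in.
have atom_of_le i j : atom_of i <= atom_of j -> i = j.
  rewrite le_eqVlt => /predU1P[/enum_val_inj/cast_ord_inj//|ij].
  have /andP[_ /existsPn/(_ (atom_of i))] := atom_of_atom j.
  by rewrite ij; have /andP[-> _] := atom_of_atom i.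
exists (fun x => [set i | atom_of i <= x]); split=> [x y|i].
  apply/subsetP/idP => [sxy|xy i]; last by rewrite !inE => /le_trans; apply.
  have [B [Batoms xE]] := atoms_gen x; rewrite [X in X <= _]xE.
  apply/joinsP => a aB.
  have [i ai] := atomE _ (Batoms a aB); rewrite ai.
  have := sxy i; rewrite !inE; apply; rewrite -ai.
  by rewrite xE; apply: (joins_sup id aB).
exists (atom_of i); apply/setP => j; rewrite !inE.
by apply/idP/eqP => [/atom_of_le|->].
Qed.

(** * Quotients *)

Section QuotientAsSubposet.
Context {d : Order.disp_t} {L : finTBLatticeType d}.
Variable a : {a : L | meet_irreducible a}.

(** The order of the quotient is that of the greatest elements of the classes,
and every element but [a] is the greatest of its class. *)
Definition class_top (p : quotient a) : L := class_max a (repr p).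

Lemma class_top_mono : {mono class_top : p q / p <= q}.
Proof. by move=> p q; rewrite le_quotientE. Qed.

Lemma class_top_pi x : x != val a -> class_top (pi_quotient a x) = x.
Proof.
by move=> /negPf xa; rewrite /class_top class_max_repr /class_max xa.
Qed.

Lemma class_top_neq p : class_top p != val a.
Proof.
rewrite /class_top /class_max; case: (eqVneq (repr p)) => // _.
by rewrite gt_eqF // lt_upper_cover.
Qed.

Lemma card_quotient : #|{: quotient a}|.+1 = #|L|.
Proof.
rewrite (cardD1 (val a)) inE add1n; congr _.+1.
rewrite -(card_codom (order_mono_inj class_top_mono)); apply: eq_card => x.
rewrite !inE andbT; apply/codomP/idP => [[p ->]|xa]; first exact: class_top_neq.
by exists (pi_quotient a x); rewrite class_top_pi.
Qed.

End QuotientAsSubposet.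

(** As a poset, the quotient is [L] without [a], so it is enough to embed [M]
into [L] with [a] as the only element missed. *)
Lemma isomorphic_quotient_of_mono (M L : finlat)
    (a : {a : L | meet_irreducible a}) (g : M -> L) :
    {mono g : x y / x <= y} -> (forall x, g x != val a) -> #|L| = #|M|.+1 ->
  isomorphic M (FinLat (quotient a)).
Proof.
move=> gmono ga cardL.
apply: (@isomorphic_of_mono M (FinLat (quotient a)) (pi_quotient a \o g)).
  by move=> x y /=; rewrite -class_top_mono !class_top_pi // gmono.
by rewrite -ltnS card_quotient cardL.
Qed.

(** The algorithm only keeps one representative of each class; this says that
nothing is lost by taking the quotients of the representative instead. *)
Lemma quotient_iso (L L' : finlat) (a : {a : L | meet_irreducible a}) :
    isomorphic L L' -> ~~ is_atom (val a) ->
  exists2 a' : {a' : L' | meet_irreducible a'}, ~~ is_atom (val a') &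
    isomorphic (FinLat (quotient a)) (FinLat (quotient a')).
Proof.
move=> /[dup] /isomorphic_card cardL /isomorphic_mono[f fmono f_bij] a_atom.
have fa_irr : meet_irreducible (f (val a)).
  by rewrite iso_meet_irreducible // (valP a).
pose a' : {a' : L' | meet_irreducible a'} := exist _ (f (val a)) fa_irr.
exists a'; first by rewrite /= iso_is_atom.
apply: (@isomorphic_quotient_of_mono (FinLat (quotient a)) L' _
  (f \o class_top (a := a))).
- by move=> p q /=; rewrite fmono class_top_mono.
- by move=> p /=; rewrite (bij_eq f_bij) class_top_neq.
- by rewrite -cardL -(card_quotient a).
Qed.

(** Composing a representation of [L] with [class_top] loses the set that
represents [a] only, and this is not a singleton since [a] is not an atom. *)
Lemma quotient_in_Lk k (L : finlat) (a : {a : L | meet_irreducible a}) :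
    (1 < k)%N -> in_Lk k L -> ~~ is_atom (val a) ->
  in_Lk k (FinLat (quotient a)).
Proof.
move=> k_gt1 /in_Lk_set_representation[s sP] a_atom.
apply: (set_representation_in_Lk (s := s \o class_top (a := a))) => //.
split=> [p q|i] /=; first by rewrite sP.1 class_top_mono.
have [x sx] := sP.2 i; exists (pi_quotient a x); rewrite class_top_pi //.
apply: contraNneq a_atom => <-.
by apply/(set_representation_atom sP k_gt1); exists i.
Qed.

(** * Closure systems *)

Record closure_system (T : finType) := ClosureSystem {
  members :> {set {set T}};
  setT_member : setT \in members;
  setI_member : {in members &, forall A B, A :&: B \in members}
}.

Section ClosureSystem.
Variables (T : finType) (F : closure_system T).

Definition closure (A : {set T}) : {set T} :=
  \bigcap_(B in members F | A \subset B) B.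

Lemma closure_member A : closure A \in members F.
Proof.
rewrite /closure; elim/big_ind: _ => [|B C|B /andP[]//].
  exact: setT_member.
exact: setI_member.
Qed.

Lemma sub_closure (A : {set T}) : A \subset closure A.
Proof. by apply/bigcapsP => B /andP[]. Qed.

Lemma closure_subE (A B : {set T}) :
  B \in members F -> (closure A \subset B) = (A \subset B).
Proof.
move=> BF; apply/idP/idP => [|AB]; first exact/subset_trans/sub_closure.
by apply: (bigcap_inf B); rewrite BF.
Qed.

Record closed_set : Type :=
  ClosedSet { closed_val : {set T}; _ : closed_val \in members F }.

HB.instance Definition _ := [isSub for closed_val].
HB.instance Definition _ := [Finite of closed_set by <:].

Definition closed_le (A B : closed_set) : bool := val A \subset val B.

Lemma closed_le_refl : reflexive closed_le.
Proof. by move=> A; apply: subxx. Qed.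

Lemma closed_le_anti : antisymmetric closed_le.
Proof. by move=> A B AB; apply/val_inj/eqP; rewrite eqEsubset. Qed.

Lemma closed_le_trans : transitive closed_le.
Proof. by move=> B A C; apply: subset_trans. Qed.

HB.instance Definition _ := Order.Le_isPOrder.Build
  Order.SetSubsetOrder.subset_display closed_set
  closed_le_refl closed_le_anti closed_le_trans.

Definition closed_meet (A B : closed_set) : closed_set :=
  @ClosedSet (val A :&: val B) (setI_member (valP A) (valP B)).

Definition close (A : {set T}) : closed_set := ClosedSet (closure_member A).

Lemma close_leE (A : {set T}) (B : closed_set) :
  (close A <= B) = (A \subset val B).
Proof. exact: closure_subE (valP B). Qed.

Lemma closed_meetP (A B C : closed_set) :
  (A <= closed_meet B C) = (A <= B) && (A <= C).
Proof. exact: subsetI. Qed.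

Lemma closed_joinP (A B C : closed_set) :
  (close (val A :|: val B) <= C) = (A <= C) && (B <= C).
Proof. by rewrite close_leE subUset. Qed.

HB.instance Definition _ := Order.POrder_MeetJoin_isLattice.Build
  Order.SetSubsetOrder.subset_display closed_set closed_meetP closed_joinP.

Lemma closed_le0x (A : closed_set) : close set0 <= A.
Proof. by rewrite close_leE sub0set. Qed.

Lemma closed_lex1 (A : closed_set) : A <= ClosedSet (setT_member F).
Proof. exact: subsetT. Qed.

HB.instance Definition _ :=
  Order.hasBottom.Build Order.SetSubsetOrder.subset_display closed_set
    closed_le0x.
HB.instance Definition _ :=
  Order.hasTop.Build Order.SetSubsetOrder.subset_display closed_set closed_lex1.

Lemma closed_leE (A B : closed_set) : (A <= B) = (val A \subset val B).
Proof. by []. Qed.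

Lemma card_closed_set : #|{: closed_set}| = #|members F|.
Proof. exact: card_sub. Qed.

End ClosureSystem.

(** The intersection of [X] with any set is [X] itself or a proper subset of
[X]; proper subsets are in [F] by minimality. *)
Lemma minimal_nonmember_setI (T : finType) (F : {set {set T}}) (X : {set T}) :
    {in F &, forall A B, A :&: B \in F} -> minset (fun A => A \notin F) X ->
  {in X |: F &, forall A B, A :&: B \in X |: F}.
Proof.
move=> FI /minsetP[_ Xmin].
have XI B : X :&: B \in X |: F.
  rewrite in_setU1; case: (boolP (X :&: B \in F)); first by rewrite orbT.
  by move=> /Xmin -> //; rewrite ?eqxx ?subsetIl.
move=> A B; rewrite 2!in_setU1 => /predU1P[->|AF] // /predU1P[->|BF].
  by rewrite setIC.
by rewrite in_setU1 FI ?orbT.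
Qed.

Lemma meet_irreducible_of_least d (L : finTBLatticeType d) (a c : L) :
  a < c -> (forall x, a < x -> c <= x) -> meet_irreducible a.
Proof.
move=> ac c_least; apply/cards1P; exists c; apply/setP => x; rewrite !inE.
apply/andP/eqP => [[ax /existsPn/(_ c)]|->].
  by rewrite ac /= lt_neqAle c_least // andbT negbK => /eqP.
by split=> //; apply/existsPn => z; apply/negP => /andP[/c_least/le_gtF->].
Qed.

(** The converse of [quotient_in_Lk]: a minimal set [X] missing from the
representation [F] of [M] is added, and then contracted to its closure. *)
Lemma in_Lk_is_quotient k (M : finlat) :
    (1 < k)%N -> in_Lk k M -> (#|M| < 2 ^ k)%N ->
  exists (L : finlat) (a : {a : L | meet_irreducible a}),
    [/\ in_Lk k L, #|L| = #|M|.+1, ~~ is_atom (val a)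
      & isomorphic M (FinLat (quotient a))].
Proof.
move=> k_gt1 /in_Lk_set_representation[s sP] cardM.
have s_inj := set_representation_inj sP.
pose F : {set {set 'I_k}} := [set s x | x : M].
have cardF : #|F| = #|M| by rewrite card_imset.
have sF x : s x \in F by rewrite imset_f.
have FT : setT \in F by rewrite -(set_representation_top sP) sF.
have FI : {in F &, forall A B, A :&: B \in F}.
  move=> _ _ /imsetP[x _ ->] /imsetP[y _ ->].
  by rewrite -(set_representation_meet sP).
have [Y YF] : exists Y, Y \notin F.
  apply/existsP; rewrite -negb_forall; apply: contraL cardM => /forallP FE.
  rewrite -leqNgt -cardF -[X in (2 ^ X)%N]card_ord -cardsT -card_powerset.
  by apply/subset_leq_card/subsetP => A _; apply: FE.
have [X Xmin _] := minset_exists (P := fun A => A \notin F) YF.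
have XF : X \notin F := minsetp Xmin.
pose F0 := ClosureSystem FT FI.
have GT : setT \in X |: F by rewrite in_setU1 FT orbT.
pose G := ClosureSystem GT (minimal_nonmember_setI FI Xmin).
have GX : X \in members G by rewrite setU11.
have GF A : A \in F -> A \in members G by move=> AF; rewrite in_setU1 AF orbT.
have X_irr : meet_irreducible (ClosedSet GX : closed_set G).
  (* The closure of X in the old family F is the least set strictly above X. *)
  apply: (@meet_irreducible_of_least _ _ _
    (ClosedSet (F := G) (GF _ (closure_member F0 X)))).
    rewrite lt_neqAle closed_leE sub_closure andbT -val_eqE /=.
    by apply: contraNneq XF => ->; apply: closure_member.
  move=> [A AG]; rewrite lt_neqAle -val_eqE !closed_leE /= => /andP[XA].
  have AF : A \in F by move: AG; rewrite in_setU1 eq_sym (negPf XA).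
  by rewrite (closure_subE (F := F0)).
have GP : set_representation (fun A : closed_set G => val A).
  split=> // i; have [x sx] := sP.2 i.
  by exists (ClosedSet (F := G) (GF _ (sF x))).
have cardG : #|{: closed_set G}| = #|M|.+1.
  by rewrite card_closed_set /= cardsU1 XF cardF.
pose a : {a : FinLat (closed_set G) | meet_irreducible a} :=
  exist _ (ClosedSet GX) X_irr.
exists (FinLat (closed_set G)), a; split=> //.
- exact: set_representation_in_Lk GP k_gt1.
- (* Atoms are represented by singletons, which all belong to F. *)
  apply: contra XF => /(set_representation_atom GP k_gt1)[i /= ->].
  by have [x <-] := sP.2 i.
- apply: (@isomorphic_quotient_of_mono M (FinLat (closed_set G)) _
    (fun x => ClosedSet (F := G) (GF _ (sF x)))) => //.
  + by move=> x y; rewrite closed_leE /= sP.1.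
  + by move=> x; rewrite -val_eqE /=; apply: contraNneq XF => <-.
Qed.

(** * The boolean lattice *)

Lemma boolean_representation k :
  set_representation (fun A : boolean_lattice k => A : {set 'I_k}).
Proof. by split=> // i; exists [set i]. Qed.

Lemma card_boolean_lattice k : #|boolean_lattice k| = (2 ^ k)%N.
Proof. by rewrite -cardsT -powersetT card_powerset cardsT card_ord. Qed.

Lemma in_Lk_card_le k (M : finlat) : in_Lk k M -> (#|M| <= 2 ^ k)%N.
Proof.
move=> /in_Lk_set_representation[s sP]; rewrite -card_boolean_lattice.
exact/leq_card/(set_representation_inj sP).
Qed.

(** A representation by all the [2 ^ k] subsets is onto. *)
Lemma in_Lk_max_isomorphic k (M : finlat) :
  in_Lk k M -> #|M| = (2 ^ k)%N -> isomorphic M (boolean_lattice k).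
Proof.
move=> /in_Lk_set_representation[s sP] cardM.
apply: (@isomorphic_of_mono M (boolean_lattice k) s); first exact: sP.1.
by rewrite card_boolean_lattice cardM.
Qed.

(** * Containers *)

Lemma occurs_in_iso V (M N : finlat) :
  isomorphic M N -> occurs_in V N -> occurs_in V M.
Proof.
move=> MN [i [L [Vi NL]]]; exists i, L; split=> //.
exact: isomorphic_trans NL.
Qed.

Lemma occurs_in_cons (L : finlat) V M :
  occurs_in (L :: V) M <-> isomorphic M L \/ occurs_in V M.
Proof.
split=> [[[|i] [K [/= Vi MK]]]|[ML|[i [K [Vi MK]]]]].
- by left; case: Vi => ->.
- by right; exists i, K.
- by exists 0%N, L.
- by exists i.+1, K.
Qed.

Lemma occurs_in_nil M : ~ occurs_in [::] M.
Proof. by case=> -[|i] [L []]. Qed.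

Lemma occurs_in_cat U V M :
  occurs_in (U ++ V) M <-> occurs_in U M \/ occurs_in V M.
Proof.
elim: U => [|L U IHU] /=; first by split=> [|[/occurs_in_nil|]] //; right.
by rewrite !occurs_in_cons IHU; tauto.
Qed.

Lemma occurs_in_map (T : eqType) (f : T -> finlat) (s : seq T) M :
  occurs_in [seq f x | x <- s] M <-> exists2 x, x \in s & isomorphic M (f x).
Proof.
elim: s => [|y s IHs] /=; first by split=> [/occurs_in_nil|[]].
rewrite occurs_in_cons IHs; split=> [[My|[x xs Mx]]|[x]].
- by exists y; rewrite ?mem_head.
- by exists x; rewrite // in_cons xs orbT.
by rewrite in_cons => /predU1P[->|xs] Mx; [left|right; exists x].
Qed.

Lemma occurs_in_lattice_quotients (L M : finlat) :
  occurs_in (lattice_quotients L) M <->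
  exists2 a : {a : L | meet_irreducible a}, ~~ is_atom (val a) &
    isomorphic M (FinLat (quotient a)).
Proof.
rewrite /lattice_quotients occurs_in_map.
split=> [[a]|[a a_atom Ma]]; last first.
  by exists a; rewrite // mem_filter a_atom mem_enum.
by rewrite mem_filter => /andP[a_atom _]; exists a.
Qed.

Lemma occurs_in_quotients W M :
  occurs_in (quotients W) M <->
  exists i (L : finlat) (a : {a : L | meet_irreducible a}),
    [/\ onth W i = Some L, ~~ is_atom (val a)
      & isomorphic M (FinLat (quotient a))].
Proof.
rewrite /quotients; elim: W => [|K W IHW] /=.
  by split=> [/occurs_in_nil|[[|i] [L [a []]]]].
rewrite occurs_in_cat occurs_in_lattice_quotients IHW.
split=> [[[a aK Ma]|[i [L [a [Wi aL Ma]]]]]|[[|i] [L [a [/= Wi aL Ma]]]]].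
- by exists 0%N, K, a.
- by exists i.+1, L, a.
- by left; case: Wi => eqKL; subst K; exists a.
- by right; exists i, L, a.
Qed.

Lemma one_rep_ext (P Q : finlat -> Prop) C :
  (forall M, P M <-> Q M) -> one_rep_per_class P C -> one_rep_per_class Q C.
Proof.
move=> PQ [CP repP]; split=> [i L Ci|M /PQ]; last exact: repP.
exact/PQ/CP/Ci.
Qed.

(** The positions of a concatenation split into those of [C] and of [D]; an
isomorphism between an entry of [C] and one of [D] is what could break
uniqueness. *)
Lemma one_rep_cat (P Q : finlat -> Prop) C D :
    (forall L M, P L -> Q M -> ~ isomorphic L M) ->
    one_rep_per_class P C -> one_rep_per_class Q D ->
  one_rep_per_class (fun M => P M \/ Q M) (C ++ D).
Proof.
move=> PQ [CP repP] [DQ repQ]; split=> [i L|M [PM|QM]]; rewrite ?onth_cat.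
- by case: ifP => _ => [/CP|/DQ]; [left|right].
- have [i [[L Ci ML] i_uniq]] := repP M PM; exists i; split=> [|j].
    by exists L; rewrite // onth_cat -onthTE Ci.
  rewrite onth_cat => -[N + MN]; case: ifP => _ => [Cj|/DQ QN].
    by apply: i_uniq; exists N.
  by case: (PQ _ _ PM QN).
- have [i [[L Di ML] i_uniq]] := repQ M QM; exists (size C + i)%N; split=> [|j].
    by exists L; rewrite // onth_cat ltnNge leq_addr addKn.
  rewrite onth_cat => -[N + MN]; case: ltnP => [_ /CP PN|Cj Dj].
    by case: (PQ _ _ PN QM); apply: isomorphic_sym.
  by rewrite (i_uniq (j - size C)%N) ?subnKC //; exists N.
Qed.

Lemma one_rep_singleton (L : finlat) :
  one_rep_per_class (fun M => isomorphic M L) [:: L].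
Proof.
split=> [i M /onth1P[_ <-]|M ML]; first exact: isomorphic_refl.
by exists 0%N; split=> [|i [N /onth1P[->]]] //; exists L.
Qed.

(** An entry is kept unless its class already occurs; deciding this uses
excluded middle. *)
Lemma exists_representatives V : exists C, one_rep_per_class (occurs_in V) C.
Proof.
elim: V => [|L V [C repC]].
  by exists [::]; split=> [[]|M /occurs_in_nil].
have [VL|nVL] := classic (occurs_in V L).
  exists C; apply: one_rep_ext repC => M; rewrite occurs_in_cons.
  by split=> [|[/occurs_in_iso/(_ VL)|]] //; right.
exists (C ++ [:: L]).
apply: one_rep_ext (one_rep_cat _ repC (one_rep_singleton L))
  => [M|K M VK ML KM].
  by rewrite occurs_in_cons; tauto.
apply: nVL; apply: occurs_in_iso VK; apply: isomorphic_sym.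
exact: isomorphic_trans ML.
Qed.

Lemma one_rep_nil P M : one_rep_per_class P [::] -> ~ P M.
Proof. by move=> [_ repP] /repP[[|i] [[L]]]. Qed.

(** * Runs of the algorithm *)

(** A quotient loses one element, so a bound on the cardinalities in [W]
decreases at each step. *)
Lemma step_Acc n (s : state) :
  (forall i L, onth s.2 i = Some L -> (#|L| < n)%N) ->
  Acc (fun t s : state => step s t) s.
Proof.
elim: n s => [|n IHn] s s_lt; constructor=> t st;
    case: st s_lt => R W W' W0 [W'Q _] s_lt.
  case: W W0 s_lt {W'Q} => [//|L W] _ s_lt.
  by have := s_lt 0%N L erefl; rewrite ltn0.
apply: IHn => i L /W'Q/occurs_in_quotients[j [K [a [Wj _ LK]]]] /=.
by rewrite (isomorphic_card LK) -ltnS card_quotient; apply: s_lt Wj.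
Qed.

(** [m] starts at [2 ^ k], the cardinality of the boolean lattice, which is the
largest possible one by [in_Lk_card_le], and decreases by one in each round. *)
Definition loop_invariant k (s : state) : Prop :=
  exists m, [/\ (m <= 2 ^ k)%N,
    one_rep_per_class (fun L => in_Lk k L /\ (m < #|L|)%N) s.1
  & one_rep_per_class (fun L => in_Lk k L /\ #|L| = m) s.2].

Lemma in_Lk_iso k (L M : finlat) :
  (1 < k)%N -> isomorphic L M -> in_Lk k M -> in_Lk k L.
Proof.
move=> k_gt1 /isomorphic_mono[f fmono [g fK gK]].
move=> /in_Lk_set_representation[s sP].
apply: (set_representation_in_Lk (s := s \o f)) => //.
split=> [x y|i] /=; first by rewrite sP.1 fmono.
by have [y sy] := sP.2 i; exists (g y); rewrite gK.
Qed.

Lemma loop_invariant_init k : (1 < k)%N -> loop_invariant k (init k).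
Proof.
move=> k_gt1; exists (2 ^ k)%N; split=> //=.
  split=> [[]//|M [/in_Lk_card_le]]; rewrite leqNgt => /negP//.
apply: one_rep_ext (one_rep_singleton (boolean_lattice k)) => M.
split=> [MB|[]]; last exact: in_Lk_max_isomorphic.
rewrite (isomorphic_card MB) card_boolean_lattice; split=> //.
apply: in_Lk_iso MB _ => //.
exact: set_representation_in_Lk (boolean_representation k) k_gt1.
Qed.

(** Left to right this is [quotient_in_Lk], right to left [in_Lk_is_quotient],
carried over to the representatives by [quotient_iso]. *)
Lemma occurs_in_quotients_in_Lk k m W M :
    (1 < k)%N -> (m < 2 ^ k)%N ->
    one_rep_per_class (fun L => in_Lk k L /\ #|L| = m.+1) W ->
  occurs_in (quotients W) M <-> in_Lk k M /\ #|M| = m.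
Proof.
move=> k_gt1 m_lt [WP repW]; rewrite occurs_in_quotients; split.
  move=> [i [L [a [Wi a_atom Ma]]]]; have [Lk cardL] := WP _ _ Wi; split.
    by apply: in_Lk_iso Ma _ => //; apply: quotient_in_Lk.
  by rewrite (isomorphic_card Ma); apply: succn_inj; rewrite card_quotient.
move=> [Mk cardM].
have [|L [a [Lk cardL a_atom Ma]]] := in_Lk_is_quotient k_gt1 Mk.
  by rewrite cardM.
have [|i [[K Wi LK] _]] := repW L; first by rewrite cardL cardM.
have [b b_atom ab] := quotient_iso LK a_atom.
by exists i, K, b; split=> //; apply: isomorphic_trans ab.
Qed.

Lemma loop_invariant_step k s t :
  (1 < k)%N -> step s t -> loop_invariant k s -> loop_invariant k t.
Proof.
move=> k_gt1; case=> R W W' W0 repW' [m [/= m_le repR repW]].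
(* m is not 0, since W has an entry and every lattice contains \bot. *)
case: m => [|m] in m_le repR repW *.
  case: W W0 repW {repW'} => [//|L W] _ [repW _].
  have [_ /card0_eq/(_ \bot)] := repW 0%N L erefl.
  by rewrite inE.
exists m; split=> /=; first exact: ltnW.
  apply: one_rep_ext (one_rep_cat _ repR repW) => [L|L M].
    rewrite [(m < _)%N]leq_eqVlt; split=> [[[Lk ->]|[Lk ->]]|[Lk]].
    - by rewrite orbT.
    - by rewrite eqxx.
    - by move=> /predU1P[<-|Lm]; [right|left].
  move=> [_ Lm] [_ cardM] /isomorphic_card cardLM.
  by move: Lm; rewrite cardLM cardM ltnn.
apply: one_rep_ext repW' => M; exact: occurs_in_quotients_in_Lk.
Qed.

(** As long as the cardinality is less than [2 ^ k], [in_Lk_is_quotient] yields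
a lattice with one more element. *)
Lemma in_Lk_card_up k n (M : finlat) :
    (1 < k)%N -> in_Lk k M -> (#|M| <= n <= 2 ^ k)%N ->
  exists2 L, in_Lk k L & #|L| = n.
Proof.
move=> k_gt1 Mk; elim: n => [|n IHn] /andP[].
  by rewrite leqn0 => /eqP cardM _; exists M.
rewrite leq_eqVlt => /predU1P[<- _|Mn n_lt]; first by exists M.
have [|L Lk cardL] := IHn; first by rewrite -ltnS Mn ltnW.
have [|K [a [Kk cardK _ _]]] := in_Lk_is_quotient k_gt1 Lk.
  by rewrite cardL.
by exists K; rewrite // cardK cardL.
Qed.

Lemma loop_invariant_final k R :
  (1 < k)%N -> loop_invariant k (R, [::]) -> one_rep_per_class (in_Lk k) R.
Proof.
move=> k_gt1 [m [/= m_le repR repW]].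
apply: one_rep_ext repR => M; split=> [[]//|Mk]; split=> //.
rewrite ltnNge; apply/negP => Mm.
have [|L Lk cardL] := @in_Lk_card_up k m M k_gt1 Mk; first by rewrite Mm.
exact: one_rep_nil repW (conj Lk cardL).
Qed.

Lemma loop_invariant_reachable k s :
  (1 < k)%N -> reachable k s -> loop_invariant k s.
Proof.
move=> k_gt1 run.
suff: loop_invariant k (init k) -> loop_invariant k s.
  by apply; apply: loop_invariant_init.
elim: run => {s} [s t|//|s t u _ IHst _ IHtu /IHst/IHtu//].
exact: loop_invariant_step.
Qed.

Theorem theorem3p2 (k : nat) (hk : 1 < k) :
  [/\ (* there is no infinite run *)
      Acc (fun t s : state => step s t) (init k),
      (* a run never gets stuck before W is empty *)
      forall R W : container,
        reachable k (R, W) -> W <> [::] -> exists t, step (R, W) t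
    & (* whatever representatives were chosen *)
      forall R : container, returns k R -> one_rep_per_class (in_Lk k) R].
Proof.
split=> [|R W _ W0|R run].
- apply: (@step_Acc (2 ^ k).+1) => -[|i] L; last by rewrite /= onth0n.
  by move=> [<-]; rewrite card_boolean_lattice.
- have [W' repW'] := exists_representatives (quotients W).
  by exists (R ++ W, W'); constructor.
- exact/(loop_invariant_final hk)/loop_invariant_reachable.
Qed.
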